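(* Let $G$ be a connected four-dimensional Lie group with Lie algebra $(\mathfrak{g},[\cdot,\cdot])$, let $\mathfrak{q}\subset\mathfrak{g}$ be a three-dimensional subspace generating $\mathfrak{g}$, and let $d$ be the left-invariant sub-Finsler quasimetric on $G$ defined by a seminorm $F$ on $\mathfrak{q}$. Assume that $\mathfrak{q}$ has an adapted basis $(e_1,e_2,e_3)$ with $e_3=[e_1,e_2]$, and let $C_{ij}^k$ be the structure constants of $\mathfrak{g}$ in the basis $(e_1,e_2,e_3,e_4=[e_1,e_3])$. For $s\in\{1,-1\}$, the abnormal extremal $$g(t)=\exp\left(\frac{ste_2}{F(se_2)}\right),\quad t\in\mathbb{R},$$ of $(G,d)$ is nonstrongly abnormal if and only if one of the following conditions is fulfilled: (i) $C_{23}^1=C_{23}^2=0$ and there exists $k(s)\in\mathbb{R}$ such that $F_U(k(s),s,0)=1/F(0,s,0)$; (ii) $C_{23}^1\neq 0$ and $F_U\left(-C_{23}^2s/C_{23}^1,\,s,\,0\right)=1/F(0,s,0)$.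
   Context: A subspace $\mathfrak{q}\subset\mathfrak{g}$ generates $\mathfrak{g}$ if the smallest Lie subalgebra containing it is $\mathfrak{g}$. An adapted basis of a three-dimensional generating subspace $\mathfrak{q}$ of a four-dimensional Lie algebra $\mathfrak{g}$ is a basis $(e_1,e_2,e_3)$ of $\mathfrak{q}$ such that $(e_1,e_2,e_3,e_4:=[e_1,e_3])$ is a basis of $\mathfrak{g}$ and, with structure constants defined by $[e_i,e_j]=\sum_k C_{ij}^k e_k$, one has $C_{12}^4=C_{23}^4=0$ (and, by definition of $e_4$, $C_{13}^1=C_{13}^2=C_{13}^3=0$, $C_{13}^4=1$). A seminorm $F$ on $\mathfrak{q}$ here is a function $F:\mathfrak{q}\to[0,\infty)$ with $F(u+v)\le F(u)+F(v)$, $F(\lambda u)=\lambda F(u)$ for $\lambda\ge 0$, and $F(u)>0$ for $u\ne 0$ (not necessarily $F(-u)=F(u)$). Put $U=\{u\in\mathfrak{q}: F(u)\le 1\}$. The left-invariant sub-Finsler quasimetric $d$ defined by $F$ is: $d(g,h)$ is the minimal time $T\ge 0$ for which there is an absolutely continuous curve from $g$ to $h$ on $[0,T]$ with $\dot g(t)=dl_{g(t)}(u(t))$ for a measurable $u(t)\in U$, where $l_g(h)=gh$. Extremals. An extremal of $(G,d)$ is an absolutely continuous curve $g:\Omega\to G$ on a maximal interval $\Omega\subset\mathbb{R}$, with a measurable control $u(t)\in\mathfrak{q}$ such that $\dot g(t)=dl_{g(t)}(u(t))$ and $F(u(t))=1$ for almost all $t$, for which there is a nowhere zero absolutely continuous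 $\psi:\Omega\to\mathfrak{g}^*$ (covectors being identified by left translations) such that for almost all $t$: $(\psi(t)(v))'=\psi(t)([u(t),v])$ for all $v\in\mathfrak{g}$, and $\psi(t)(u(t))=\max_{u\in U}\psi(t)(u)=M$ with a constant $M\ge 0$ (Pontryagin Maximum Principle). The extremal is abnormal (with respect to $\psi$) if $M=0$ and normal (with respect to $\psi$) if $M>0$. It is nonstrongly abnormal if it is abnormal with respect to some $\psi$ and normal with respect to another $\psi$; an abnormal extremal that is not nonstrongly abnormal is strongly abnormal. In the coordinates of the basis $(e_1,e_2,e_3)$: $F(u_1,u_2,u_3):=F(u_1e_1+u_2e_2+u_3e_3)$ and $F_U(x,y,z)=\max_{(u_1,u_2,u_3)\in U}(xu_1+yu_2+zu_3)$. *)

(* Defs.v *)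
From HB Require Import structures.
From mathcomp Require Import all_boot all_order all_algebra.
From mathcomp Require Import all_classical all_reals all_analysis.
Set Implicit Arguments.
Unset Strict Implicit.
Unset Printing Implicit Defensive.
Import Order.TTheory GRing.Theory Num.Theory.
Import numFieldNormedType.Exports.
Local Open Scope classical_set_scope.
Local Open Scope ring_scope.

(* A type carrying a group law and a topology; their compatibility is part of
   [lie_group] below. *)
#[short(type="topologicalGroupType")]
HB.structure Definition TopologicalGroup := {G of Group G & Topological G}.

(* C^k on an open set A of a finite-dimensional space: all iterated directional
   derivatives up to order k exist and are continuous on A. *)
Fixpoint Ck (R : realType) (V W : normedModType R) (k : nat)
    (A : set V) (f : V -> W) : Prop :=
  (forall x, A x -> {for x, continuous f}) /\
  (if k is k'.+1 then
     forall v, (forall x, A x -> derivable f x v) /\ Ck k' A (fun x => 'D_v f x)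
   else True).

Definition smooth (R : realType) (V W : normedModType R)
  (A : set V) (f : V -> W) : Prop := forall k, Ck k A f.

Record chart (R : realType) (V : normedModType R) (M : topologicalType) := Chart {
  cdom : set M;
  ccod : set V;
  cfun : M -> V;
  cinv : V -> M;
  cdom_open : open cdom;
  ccod_open : open ccod;
  cfun_cod : forall m, cdom m -> ccod (cfun m);
  cinv_dom : forall x, ccod x -> cdom (cinv x);
  cfunK : forall m, cdom m -> cinv (cfun m) = m;
  cinvK : forall x, ccod x -> cfun (cinv x) = x;
  cfun_continuous : forall m, cdom m -> {for m, continuous cfun};
  cinv_continuous : forall x, ccod x -> {for x, continuous cinv} }.

(* Smoothness, on an open subset D of a normed space, of a map into the manifold
   with atlas A. *)
Definition smooth_into (R : realType) (V W : normedModType R)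
    (M : topologicalType) (A : set (chart V M)) (D : set W) (p : W -> M) : Prop :=
  (forall x, D x -> {for x, continuous p}) /\
  (forall c, A c -> smooth (D `&` p @^-1` cdom c) (cfun c \o p)).

Definition smooth_fun (R : realType) (V : normedModType R)
    (M : topologicalType) (A : set (chart V M)) (f : M -> R) : Prop :=
  forall c, A c -> smooth (ccod c) (f \o cinv c).

(* [lg_compat] says that the transition maps are smooth. *)
Record lie_group (R : realType) (V : normedModType R)
    (G : topologicalGroupType) (A : set (chart V G)) : Prop := LieGroup {
  lg_hausdorff : hausdorff_space G;
  lg_second_countable : @second_countable G;
  lg_cover : forall x : G, exists2 c, A c & cdom c x;
  lg_compat : forall c, A c -> smooth_into A (ccod c) (cinv c);
  lg_mul : forall c c', A c -> A c' ->
    smooth_into A (ccod c `*` ccod c')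
      (fun p : V * V => (cinv c p.1 * cinv c' p.2)%g);
  lg_inv : forall c, A c ->
    smooth_into A (ccod c) (fun x => (cinv c x)^-1%g) }.

(* A vector field is a derivation of the algebra of smooth functions on G.  It
   is represented by an operator on all functions, of which only the values on
   smooth functions matter. *)
Record left_invariant_field (R : realType) (V : normedModType R)
    (G : topologicalGroupType) (A : set (chart V G))
    (D : (G -> R) -> (G -> R)) : Prop := LeftInvariantField {
  lif_smooth : forall f, smooth_fun A f -> smooth_fun A (D f);
  lif_linear : forall (a : R) f h, smooth_fun A f -> smooth_fun A h ->
    D (fun x => a * f x + h x) = (fun x => a * D f x + D h x);
  lif_leibniz : forall f h, smooth_fun A f -> smooth_fun A h ->
    D (fun x => f x * h x) = (fun x => f x * D h x + h x * D f x);
  lif_left : forall (a : G) f, smooth_fun A f ->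
    D (fun x => f (a * x)%g) = (fun x => D f (a * x)%g) }.

(* (g, br) is, through the linear bijection X, the Lie algebra of left-invariant
   vector fields on G with the commutator bracket.  X v is the left-invariant
   field with value v at the identity, so that the tangent vector dl_x(v) at x is
   the derivation f |-> X v f x. *)
Record lie_algebra_of (R : realType) (V : normedModType R)
    (G : topologicalGroupType) (A : set (chart V G)) (g : vectType R)
    (br : g -> g -> g) (X : g -> (G -> R) -> (G -> R)) : Prop := LieAlgebraOf {
  la_field : forall v, left_invariant_field A (X v);
  la_linear : forall (a : R) v w f, smooth_fun A f ->
    X (a *: v + w) f = (fun x => a * X v f x + X w f x);
  la_bracket : forall v w f, smooth_fun A f ->
    X (br v w) f = (fun x => X v (X w f) x - X w (X v f) x);
  la_inj : forall v w, (forall f, smooth_fun A f -> X v f = X w f) -> v = w;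
  la_surj : forall D, left_invariant_field A D ->
    exists v, forall f, smooth_fun A f -> D f = X v f }.

(* The curve c has at time t the velocity dl_{c(t)}(v). *)
Definition has_velocity (R : realType) (V : normedModType R)
    (G : topologicalGroupType) (A : set (chart V G)) (g : vectType R)
    (X : g -> (G -> R) -> (G -> R)) (c : R -> G) (t : R) (v : g) : Prop :=
  forall f, smooth_fun A f -> is_derive t (1 : R) (f \o c) (X v f (c t)).

(* e is the exponential map: for every v, t |-> e(t v) is the one-parameter
   subgroup with initial velocity v. *)
Definition is_exp (R : realType) (V : normedModType R)
    (G : topologicalGroupType) (A : set (chart V G)) (g : vectType R)
    (X : g -> (G -> R) -> (G -> R)) (e : g -> G) : Prop :=
  forall v, [/\ forall s t : R, e ((s + t) *: v) = (e (s *: v) * e (t *: v))%g,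
    smooth_into A [set: R] (fun t : R => e (t *: v)) &
    has_velocity A X (fun t : R => e (t *: v)) 0 v].

Definition generates (R : realType) (g : vectType R) (br : g -> g -> g)
    (q : {vspace g}) : Prop :=
  forall h : {vspace g}, (q <= h)%VS ->
    (forall v w, v \in h -> w \in h -> br v w \in h) -> h = fullv.

Definition frame4 (R : realType) (g : vectType R) (br : g -> g -> g)
  (e1 e2 e3 : g) : 4.-tuple g := [tuple e1; e2; e3; br e1 e3].

(* C_ij^k with indices running from 1 to 4. *)
Definition struct_const (R : realType) (g : vectType R) (br : g -> g -> g)
    (e : 4.-tuple g) (i j k : nat) : R :=
  coord e (inord k.-1) (br e`_i.-1 e`_j.-1).

Record adapted_basis (R : realType) (g : vectType R) (br : g -> g -> g)
    (q : {vspace g}) (e1 e2 e3 : g) : Prop := AdaptedBasis {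
  ab_basis_q : basis_of q [:: e1; e2; e3];
  ab_basis : basis_of fullv (frame4 br e1 e2 e3);
  ab_C124 : struct_const br (frame4 br e1 e2 e3) 1%N 2%N 4%N = 0;
  ab_C234 : struct_const br (frame4 br e1 e2 e3) 2%N 3%N 4%N = 0 }.

(* A positive definite, possibly non-symmetric, norm on q; the values of F
   outside q are irrelevant. *)
Record seminorm_on (R : realType) (g : vectType R) (q : {vspace g})
    (F : g -> R) : Prop := SeminormOn {
  sn_ge0 : forall u, u \in q -> 0 <= F u;
  sn_triangle : forall u v, u \in q -> v \in q -> F (u + v) <= F u + F v;
  sn_homogeneous : forall (l : R) u, 0 <= l -> u \in q -> F (l *: u) = l * F u;
  sn_gt0 : forall u, u \in q -> u != 0 -> 0 < F u }.

Definition unit_ball (R : realType) (g : vectType R) (q : {vspace g})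
  (F : g -> R) : set g := [set u | u \in q /\ F u <= 1].

Definition F_coord (R : realType) (g : vectType R) (F : g -> R)
  (e1 e2 e3 : g) (u1 u2 u3 : R) : R := F (u1 *: e1 + u2 *: e2 + u3 *: e3).

(* The supremum is a maximum, the unit ball being compact. *)
Definition F_U (R : realType) (g : vectType R) (F : g -> R)
    (e1 e2 e3 : g) (x y z : R) : R :=
  sup [set r | exists u1 u2 u3 : R, F_coord F e1 e2 e3 u1 u2 u3 <= 1 /\
                                    r = x * u1 + y * u2 + z * u3].

Definition abs_cont (R : realType) (W : normedModType R) (a b : R)
    (f : R -> W) : Prop :=
  forall eps : R, 0 < eps -> exists2 delta : R, 0 < delta &
    forall (n : nat) (x y : 'I_n -> R),
      (forall i, [/\ a <= x i, x i <= y i & y i <= b]) ->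
      trivIset [set: 'I_n] (fun i => [set` `]x i, y i[]) ->
      \sum_(i < n) (y i - x i) < delta ->
      \sum_(i < n) `|f (y i) - f (x i)| < eps.

(* On a noncompact interval, absolute continuity is meant on each compact
   subinterval. *)
Definition abs_cont_curve (R : realType) (V : normedModType R)
    (M : topologicalType) (A : set (chart V M)) (I : set R) (c : R -> M) : Prop :=
  {within I, continuous c} /\
  forall phi, A phi -> forall a b : R, `[a, b] `<=` I ->
    (forall t : R, t \in `[a, b] -> cdom phi (c t)) -> abs_cont a b (cfun phi \o c).

Definition measurable_control (R : realType) (g : vectType R) (I : set R)
    (u : R -> g) : Prop :=
  forall l : 'Hom(g, R^o), measurable_fun I (fun t : R => l (u t) : R).

Definition sub_finsler_quasimetric (R : realType) (V : normedModType R)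
    (G : topologicalGroupType) (A : set (chart V G)) (g : vectType R)
    (X : g -> (G -> R) -> (G -> R)) (q : {vspace g}) (F : g -> R)
    (d : G -> G -> R) : Prop :=
  forall x y : G,
    let times := [set T : R | 0 <= T /\ exists (c : R -> G) (u : R -> g),
      [/\ abs_cont_curve A `[0, T] c, c 0 = x, c T = y,
          measurable_control `[0, T] u /\
          (forall t : R, t \in `[0, T] -> unit_ball q F (u t)) &
          {ae @lebesgue_measure R, forall t : R,
             t \in `[0, T] -> has_velocity A X c t (u t)}]] in
    times (d x y) /\ lbound times (d x y).

(* The curve c on the interval I, the control u, the covector function psi (in
   left trivialization) and the constant M satisfy the Pontryagin Maximum
   Principle. *)
Record pmp (R : realType) (V : normedModType R)
    (G : topologicalGroupType) (A : set (chart V G)) (g : vectType R)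
    (br : g -> g -> g) (X : g -> (G -> R) -> (G -> R))
    (q : {vspace g}) (F : g -> R)
    (I : set R) (c : R -> G) (u : R -> g) (psi : R -> 'Hom(g, R^o)) (M : R)
    : Prop := Pmp {
  pmp_interval : is_interval I;
  pmp_curve : abs_cont_curve A I c;
  pmp_measurable : measurable_control I u;
  pmp_control : {ae @lebesgue_measure R, forall t : R, I t ->
    [/\ u t \in q, F (u t) = 1 & has_velocity A X c t (u t)]};
  pmp_neq0 : forall t, I t -> psi t != 0;
  pmp_abs_cont : forall v (a b : R), `[a, b] `<=` I ->
    abs_cont a b (fun t => psi t v);
  pmp_adjoint : {ae @lebesgue_measure R, forall t : R, I t ->
    forall v, is_derive t (1 : R) (fun r => psi r v) (psi t (br (u t) v))};
  pmp_ge0 : 0 <= M;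
  pmp_max : {ae @lebesgue_measure R, forall t : R, I t ->
    psi t (u t) = M /\ forall v, unit_ball q F v -> psi t v <= psi t (u t)} }.

Definition extremal (R : realType) (V : normedModType R)
    (G : topologicalGroupType) (A : set (chart V G)) (g : vectType R)
    (br : g -> g -> g) (X : g -> (G -> R) -> (G -> R))
    (q : {vspace g}) (F : g -> R) (I : set R) (c : R -> G) (u : R -> g) : Prop :=
  (exists psi M, pmp A br X q F I c u psi M) /\
  (forall I' c' u' psi' M', I `<=` I' -> (forall t, I t -> c' t = c t) ->
     pmp A br X q F I' c' u' psi' M' -> I' = I).

Definition abnormal_extremal (R : realType) (V : normedModType R)
    (G : topologicalGroupType) (A : set (chart V G)) (g : vectType R)
    (br : g -> g -> g) (X : g -> (G -> R) -> (G -> R))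
    (q : {vspace g}) (F : g -> R) (I : set R) (c : R -> G) : Prop :=
  exists u, extremal A br X q F I c u /\
    exists psi, pmp A br X q F I c u psi 0.

Definition nonstrongly_abnormal (R : realType) (V : normedModType R)
    (G : topologicalGroupType) (A : set (chart V G)) (g : vectType R)
    (br : g -> g -> g) (X : g -> (G -> R) -> (G -> R))
    (q : {vspace g}) (F : g -> R) (I : set R) (c : R -> G) : Prop :=
  exists u, [/\ extremal A br X q F I c u,
    exists psi, pmp A br X q F I c u psi 0 &
    exists psi M, 0 < M /\ pmp A br X q F I c u psi M].

(* Main.v *)
Require Import Defs.
From mathcomp Require Import all_boot all_order all_algebra.
From mathcomp Require Import all_classical all_reals all_analysis.
From mathcomp Require Import ring lra.
Set Implicit Arguments.
Unset Strict Implicit.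
Unset Printing Implicit Defensive.
Import Order.TTheory GRing.Theory Num.Theory.
Import numFieldNormedType.Exports.
Local Open Scope classical_set_scope.
Local Open Scope ring_scope.

(* Put y = s / F(s e2) and u = y e2, the velocity of the curve.  An abnormal
   covector vanishes on q, so it is carried by e4, and the Jacobi identity gives
   [e2, e4] = C232 e3 + C233 e4: exp(y C233 t) times the e4-coordinate is a
   solution.  A normal covector psi satisfies psi(u) = M and psi <= M on the unit
   ball, hence psi(e2) = M s F(s e2) and psi is bounded on q.  For x in q the
   derivative psi([u, x]) of the bounded function psi(x) cannot stay on one side
   away from 0; therefore, if v = z + [u, x] lies in the unit ball and [u, z] = 0,
   then the constant psi(z) is at most M.  Choosing x so that z has no
   e3-component yields the value of F_U when C231 <> 0, and forces C232 = 0 when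
   C231 = 0.  Conversely, a constant covector (k, s, 0, 0) solves the adjoint
   equation as soon as C231 k + C232 s = 0. *)

(** * Composition of C^k maps *)

Lemma is_derive_line (R : realType) (V W : normedModType R) (f : V -> W)
    (p v : V) (t : R) :
  derivable f (t *: v + p) v ->
  is_derive t (1 : R) (fun r : R => f (r *: v + p)) ('D_v f (t *: v + p)).
Proof.
have E : (fun h : R => h^-1 *: (((fun r : R => f (r *: v + p)) \o shift t)
      (h *: (1 : R)) - f (t *: v + p))) =
    (fun h : R => h^-1 *: ((f \o shift (t *: v + p)) (h *: v) - f (t *: v + p))).
  by apply/funext => h /=; rewrite [h *: 1]mulr1 scalerDl addrA.
by move=> dfv; split; rewrite /derivable /derive E.
Qed.

(** The mean value theorem on the segment from [p] to [s *: v + p], which stays in the ball around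
    [x]. The bound on [z] forces [z] to tend to [x] when [p] does and [s] tends to 0. *)
Lemma line_MVT (R : realType) (V : normedModType R) (B : set V) (f : V -> R)
    (x p v : V) (r s : R) :
  ball x r `<=` B ->
  (forall y, B y -> {for y, continuous f}) ->
  (forall y, B y -> derivable f y v) ->
  `|p - x| + `|s *: v| < r ->
  exists2 z, `|z - x| <= `|p - x| + `|s *: v| &
    f (s *: v + p) - f p = s * 'D_v f z.
Proof.
move=> xB cf df pr.
have near_x t : `|t| <= `|s| -> `|t *: v + p - x| <= `|p - x| + `|s *: v|.
  move=> ts; rewrite -addrA addrC (le_trans (ler_normD _ _))// lerD2l.
  by rewrite !normrZ ler_wpM2r.
have inB t : `|t| <= `|s| -> B (t *: v + p).
  move=> /near_x ts; apply: xB; rewrite -ball_normE /= distrC.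
  exact: le_lt_trans pr.
have cline t : `|t| <= `|s| -> {for t, continuous (fun t : R => f (t *: v + p))}.
  move=> ts; apply: (@continuous_comp _ _ _ (fun t : R => t *: v + p) f).
    apply: continuousD; last exact: cst_continuous.
    exact: scalel_continuous.
  exact: cf (inB _ ts).
have dline t : `|t| <= `|s| ->
    is_derive t (1 : R) (fun t : R => f (t *: v + p)) ('D_v f (t *: v + p)).
  by move=> ts; apply: is_derive_line; exact/df/inB.
have [s0|s0] := leP 0 s.
- have [|||t] := @MVT_segment R (fun t : R => f (t *: v + p))
    (fun t => 'D_v f (t *: v + p)) 0 s.
  + by [].
  + move=> t; rewrite in_itv/= => /andP[t0 ts]; apply: dline.
    by rewrite !ger0_norm// ltW.
  + apply: continuous_in_subspaceT => t; rewrite inE/= in_itv/= => /andP[t0 ts].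
    by apply: cline; rewrite !ger0_norm.
  rewrite in_itv/= => /andP[t0 ts].
  rewrite scale0r add0r subr0 mulrC => ->; exists (t *: v + p) => //.
  by apply: near_x; rewrite !ger0_norm.
- have [|||t] := @MVT_segment R (fun t : R => f (t *: v + p))
    (fun t => 'D_v f (t *: v + p)) s 0.
  + exact: ltW.
  + move=> t; rewrite in_itv/= => /andP[ts t0]; apply: dline.
    by rewrite !ltr0_norm// lerN2 ltW.
  + apply: continuous_in_subspaceT => t; rewrite inE/= in_itv/= => /andP[ts t0].
    by apply: cline; rewrite !ler0_norm ?lerN2// ltW.
  rewrite in_itv/= => /andP[ts t0].
  rewrite scale0r add0r sub0r mulrN => e; exists (t *: v + p).
    by apply: near_x; rewrite !ler0_norm ?lerN2// ltW.
  by rewrite -opprB e opprK mulrC.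
Qed.

(* The base point of the increment moves with [t]: this is what the telescoping
   along the coordinate axes requires. *)
Lemma cvg_line_quotient (R : realType) (V : normedModType R) (B : set V)
    (f : V -> R) (x v : V) (p : R -> V) (s : R -> R) (l : R) :
  open B -> B x ->
  (forall y, B y -> {for y, continuous f}) ->
  (forall y, B y -> derivable f y v) ->
  {for x, continuous (fun y => 'D_v f y)} ->
  p t @[t --> 0^'] --> x -> s t @[t --> 0^'] --> 0 ->
  t^-1 * s t @[t --> 0^'] --> l ->
  t^-1 * (f (s t *: v + p t) - f (p t)) @[t --> 0^'] --> l * 'D_v f x.
Proof.
move=> oB Bx cf df cDf px s0 sl.
have /nbhs_ballP[r /= r0 xB] : nbhs x B by exact: open_nbhs_nbhs.
pose d t := `|p t - x| + `|s t *: v|.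
have d0 : d t @[t --> 0^'] --> 0.
  rewrite -[X in _ --> X]addr0; apply: cvgD.
    by apply/norm_cvg0P/subr_cvg0.
  apply/norm_cvg0P; rewrite -[X in _ --> X](scale0r v); exact: cvgZr_tmp.
have zP t : exists z, d t < r -> `|z - x| <= d t /\
    f (s t *: v + p t) - f (p t) = s t * 'D_v f z.
  have [dr|] := ltP (d t) r; last by exists x.
  by have [z] := line_MVT xB cf df dr; exists z.
have [z {}zP] := choice zP.
have dr : \forall t \near 0^', d t < r.
  by apply: (cvgr_lt 0).
have zx : z t @[t --> 0^'] --> x.
  apply/cvgrPdist_lt => e e0; near=> t.
  have tr : d t < r by near: t.
  have [zd _] := zP _ tr; rewrite distrC (le_lt_trans zd)//.
  by near: t; exact: (cvgr_lt 0).
apply: (@cvg_trans _ ((t^-1 * s t) * 'D_v f (z t) @[t --> 0^'])).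
  apply: near_eq_cvg; near=> t.
  have tr : d t < r by near: t.
  by have [_ ->] := zP _ tr; rewrite mulrA.
by apply: cvgM => //; exact: cvg_comp zx cDf.
Unshelve. all: by end_near. Qed.

(** Chain rule from partial derivatives: the increment of [h] is cut into steps along the coordinate
    axes, each step contributes one partial derivative of [f] by [cvg_line_quotient], and the steps
    telescope. *)
Lemma is_derive_comp_rV (R : realType) (W : normedModType R) (n : nat)
    (B : set 'rV[R]_n) (f : 'rV[R]_n -> R) (h : W -> 'rV[R]_n) (x v : W) :
  open B -> B (h x) -> Ck 1 B f -> derivable h x v ->
  is_derive x v (f \o h)
    (\sum_(i < n) 'D_v (fun y => h y 0 i) x * 'D_(delta_mx 0 i) f (h x)).
Proof.
move=> oB Bhx [cf /= df] dh.
pose y (t : R) := h (t *: v + x) - h x.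
(* The broken path from [h x] to [h (t *: v + x)] after its first [k] coordinates have been
   moved. *)
pose p (k : nat) (t : R) :=
  h x + \sum_(i < n | (i < k)%N) y t 0 i *: delta_mx 0 i.
have pS (i : 'I_n) t : y t 0 i *: delta_mx 0 i + p i t = p i.+1 t.
  rewrite /p addrCA; congr (_ + _).
  rewrite [RHS](bigD1 i)//=; congr (_ + _); apply: eq_bigl => j.
  by rewrite ltnS ltn_neqAle andbC.
have p0 t : p 0%N t = h x by rewrite /p big_pred0 ?addr0.
have pn t : p n t = h (t *: v + x).
  rewrite /p (eq_bigl xpredT) => [|i]; last by rewrite ltn_ord.
  by rewrite -row_sum_delta /y addrCA subrr addr0.
have sl (i : 'I_n) :
    t^-1 * y t 0 i @[t --> 0^'] --> 'D_v (fun y => h y 0 i) x.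
  have /derivable_mxP/(_ 0 i) dhi := dh.
  by under eq_fun do rewrite /y 2!mxE; exact: dhi.
have s0 (i : 'I_n) : y t 0 i @[t --> 0^'] --> 0.
  have : t * (t^-1 * y t 0 i) @[t --> 0^'] --> 0 * 'D_v (fun y => h y 0 i) x.
    by apply: cvgM => //; exact: nbhs_dnbhs.
  rewrite mul0r; apply: cvg_trans; apply: near_eq_cvg; near=> t.
  by rewrite mulrA divff ?mul1r//; near: t; exact: nbhs_dnbhs_neq.
have px k : p k t @[t --> 0^'] --> h x.
  have : p k t @[t --> 0^'] -->
      h x + \sum_(i < n | (i < k)%N) 0 *: (delta_mx 0 i : 'rV[R]_n).
    apply: cvgD; first exact: cvg_cst.
    by apply: (cvg_big add_continuous) => i _; exact: cvgZr_tmp.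
  by rewrite big1 ?addr0// => i _; rewrite scale0r.
have : (\sum_(i < n) t^-1 * (f (y t 0 i *: delta_mx 0 i + p i t) - f (p i t)))
    @[t --> 0^'] -->
    \sum_(i < n) 'D_v (fun y => h y 0 i) x * 'D_(delta_mx 0 i) f (h x).
  apply: (cvg_big add_continuous) => i _; have [dfi [cDf _]] := df (delta_mx 0 i).
  exact: cvg_line_quotient oB Bhx cf dfi (cDf _ Bhx) (px i) (s0 i) (sl i).
have -> : (fun t => \sum_(i < n)
      t^-1 * (f (y t 0 i *: delta_mx 0 i + p i t) - f (p i t))) =
    (fun t => t^-1 *: (((f \o h) \o shift x) (t *: v) - (f \o h) x)).
  apply/funext => t; rewrite -mulr_sumr /=; congr (_ * _).
  under eq_bigr do rewrite pS.
  rewrite -(big_mkord xpredT (fun i => f (p i.+1 t) - f (p i t))).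
  by rewrite telescope_sumr// pn p0.
by move=> Q; split; [apply/cvg_ex; eexists; exact: Q|exact: (cvg_lim _ Q)].
Unshelve. all: by end_near. Qed.

Section Ck_calculus.
Context {R : realType}.
Implicit Types V W : normedModType R.

Lemma CkS V W k (A : set V) (f : V -> W) : Ck k.+1 A f -> Ck k A f.
Proof.
elim: k f => [|k IH] f /= [cf df]; split=> // v.
by have [? ?] := df v; split=> //; exact: IH.
Qed.

Lemma Ck_local V W k (A : set V) (f : V -> W) :
  (forall x, A x -> exists2 B, B x & Ck k B f) -> Ck k A f.
Proof.
elim: k f => [|k IH] f Af; split=> //.
- by move=> x /Af[B Bx [cf _]]; exact: cf.
- by move=> x /Af[B Bx [cf _]]; exact: cf.
- move=> v; split; first by move=> x /Af[B Bx [_ /(_ v)[df _]]]; exact: df.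
  by apply: IH => x /Af[B Bx [_ /(_ v)[_ ?]]]; exists B.
Qed.

Lemma Ck_sub V W k (A B : set V) (f : V -> W) : A `<=` B -> Ck k B f -> Ck k A f.
Proof. by move=> AB fB; apply: Ck_local => x Ax; exists B => //; exact: AB. Qed.

Lemma Ck_eq V W k (A : set V) (f g : V -> W) : open A ->
  (forall x, A x -> f x = g x) -> Ck k A f -> Ck k A g.
Proof.
move=> oA; elim: k f g => [|k IH] f g fg [cf df].
  split=> // x Ax; have fgx : {near x, f =1 g}.
    by near=> z; apply: fg; near: z; exact: open_nbhs_nbhs.
  rewrite /prop_for /continuous_at -(fg x)//.
  exact: cvg_trans (near_eq_cvg fgx) (cf x Ax).
have fgx x : A x -> {near x, f =1 g}.
  by move=> Ax; near=> z; apply: fg; near: z; exact: open_nbhs_nbhs.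
split=> [x Ax|v].
  rewrite /prop_for /continuous_at -(fg x)//.
  exact: cvg_trans (near_eq_cvg (fgx x Ax)) (cf x Ax).
have [dfv Dfv] := df v; split=> [x Ax|].
  exact: near_eq_derivable (fgx x Ax) (dfv x Ax).
apply: IH Dfv => x Ax; apply: near_eq_derive; exact: fgx.
Unshelve. all: by end_near. Qed.

Lemma Ck_cst V W k (A : set V) (w : W) : Ck k A (cst w).
Proof.
elim: k w => [|k IH] w; split=> //; try by move=> x _; exact: cst_continuous.
move=> v; split=> [x _|]; first exact: derivable_cst.
by have -> : (fun x => 'D_v (cst w) x) = cst 0 by apply/funext => x; exact: derive_cst.
Qed.

Lemma CkD V W k (A : set V) (f g : V -> W) : open A ->
  Ck k A f -> Ck k A g -> Ck k A (fun x => f x + g x).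
Proof.
move=> oA; elim: k f g => [|k IH] f g [cf df] [cg dg].
  by split=> // x Ax; apply: continuousD; [exact: cf|exact: cg].
split=> [x Ax|v]; first by apply: continuousD; [exact: cf|exact: cg].
have [dfv Dfv] := df v; have [dgv Dgv] := dg v.
split=> [x Ax|]; first by apply: derivableD; [exact: dfv|exact: dgv].
apply: Ck_eq (IH _ _ Dfv Dgv) => // x Ax.
by rewrite -deriveD//; [exact: dfv|exact: dgv].
Qed.

Lemma CkM V k (A : set V) (f g : V -> R) : open A ->
  Ck k A f -> Ck k A g -> Ck k A (fun x => f x * g x).
Proof.
move=> oA; elim: k f g => [|k IH] f g.
  by move=> [cf _] [cg _]; split=> // x Ax; apply: continuousM; [exact: cf|exact: cg].
move=> fk gk; have [cf df] := fk; have [cg dg] := gk.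
split=> [x Ax|v]; first by apply: continuousM; [exact: cf|exact: cg].
have [dfv Dfv] := df v; have [dgv Dgv] := dg v.
split=> [x Ax|]; first by apply: derivableM; [exact: dfv|exact: dgv].
apply: Ck_eq (CkD oA (IH _ _ (CkS fk) Dgv) (IH _ _ (CkS gk) Dfv)) => // x Ax.
exact: esym (deriveM (dfv x Ax) (dgv x Ax)).
Qed.

Lemma Ck_sum V k n (A : set V) (f : 'I_n -> V -> R) : open A ->
  (forall i, Ck k A (f i)) -> Ck k A (fun x => \sum_(i < n) f i x).
Proof.
move=> oA; elim: n f => [|n IH] f fk.
  by under eq_fun do rewrite big_ord0; exact: Ck_cst.
under eq_fun do rewrite big_ord_recl; apply: CkD => //.
exact: (IH (fun i => f (lift ord0 i))).
Qed.

Lemma Ck_coord V k n (A : set V) (h : V -> 'rV[R]_n) (i : 'I_n) : open A ->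
  Ck k A h -> Ck k A (fun x => h x 0 i).
Proof.
move=> oA; elim: k h => [|k IH] h [ch dh].
  split=> // x Ax; apply: (@continuous_comp _ _ _ h (fun M : 'rV[R]_n => M 0 i)).
    exact: ch.
  exact: coord_continuous.
split=> [x Ax|v].
  apply: (@continuous_comp _ _ _ h (fun M : 'rV[R]_n => M 0 i)); first exact: ch.
  exact: coord_continuous.
have [dhv Dhv] := dh v; split=> [x Ax|].
  by have /derivable_mxP := dhv x Ax; exact.
by apply: Ck_eq (IH _ Dhv) => // x Ax; rewrite derive_mx ?mxE//; exact: dhv.
Qed.

(** Induction on [k]: by the chain rule a derivative of [f \o h] is a sum of products, whose factors
    are a derivative of a coordinate of [h] and a partial derivative of [f] composed with [h]; the
    latter falls under the induction hypothesis. *)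
Lemma Ck_comp W k n (A : set W) (B : set 'rV[R]_n)
    (f : 'rV[R]_n -> R) (h : W -> 'rV[R]_n) :
  open A -> open B -> (forall x, A x -> B (h x)) ->
  Ck k B f -> Ck k A h -> Ck k A (f \o h).
Proof.
move=> oA oB AB; elim: k f => [|k IH] f.
  move=> [cf _] [ch _]; split=> // x Ax.
  by apply: continuous_comp; [exact: ch|apply: cf; exact: AB].
move=> fk hk; have [cf df] := fk; have [ch dh] := hk.
split=> [x Ax|v].
  by apply: continuous_comp; [exact: ch|apply: cf; exact: AB].
have f1 : Ck 1 B f.
  split=> // w; have [dfw Dfw] := df w; split=> //; split=> //.
  by case: (k) Dfw => [|?] [].
have [dhv Dhv] := dh v.
have D x : A x -> is_derive x v (f \o h)
    (\sum_(i < n) 'D_v (fun y => h y 0 i) x * 'D_(delta_mx 0 i) f (h x)).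
  by move=> Ax; apply: (is_derive_comp_rV oB) => //; [exact: AB|exact: dhv].
split=> [x /D[]//|].
apply: (@Ck_eq _ _ _ _ (fun x => \sum_(i < n)
    'D_v (fun y => h y 0 i) x * 'D_(delta_mx 0 i) f (h x))) => //.
  by move=> x /D[].
apply: Ck_sum => // i; apply: CkM => //.
  by have [_ /= /(_ v)[]] := Ck_coord i oA hk.
by apply: (IH ('D_(delta_mx 0 i) f)); [have [] := df (delta_mx 0 i)|exact: CkS].
Qed.

End Ck_calculus.

(** * Absolutely continuous functions *)

Section absolute_continuity.
Context {R : realType}.
Local Notation mu := (@lebesgue_measure R).

(* [filterS] does not apply: for predicates on [R] the filter instance of
   [almost_everywhere mu] is not inferred. *)
Lemma ae_sub (P Q : R -> Prop) : (forall t, P t -> Q t) ->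
  {ae mu, forall t, P t} -> {ae mu, forall t, Q t}.
Proof.
by move=> PQ [N [mN N0 PN]]; exists N; split=> // t nQ; apply: PN => /PQ.
Qed.

Lemma ae_and (P Q : R -> Prop) :
  {ae mu, forall t, P t} -> {ae mu, forall t, Q t} ->
  {ae mu, forall t, P t /\ Q t}.
Proof.
move=> [N [mN N0 PN]] [M [mM M0 QM]]; exists (N `|` M); split.
- exact: measurableU.
- by rewrite measureU0.
- move=> t /= /not_andP[nP|nQ]; [left; exact: PN|right; exact: QM].
Qed.

Lemma ae_all (P : R -> Prop) : (forall t, P t) -> {ae mu, forall t, P t}.
Proof.
by move=> Pt; exists set0; split=> //= t; apply; exact: Pt.
Qed.

(** Continuous induction: let [S] collect the [x] with [P a x]. The local hypothesis at [sup S]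
    first gives [P a (sup S)], then a larger element of [S] unless [sup S = b]. *)
Lemma cousin (P : R -> R -> Prop) (a b : R) :
  a <= b ->
  (forall x y z, x <= y -> y <= z -> P x y -> P y z -> P x z) ->
  (forall t, a <= t <= b -> exists2 r, 0 < r &
    forall x y, a <= x -> x <= t -> t <= y -> y <= b -> t - r < x -> y < t + r ->
      P x y) ->
  P a b.
Proof.
move=> ab PD Ploc.
pose S := [set x | a <= x <= b /\ P a x].
have Sa : S a.
  split; first by rewrite lexx.
  have [|r r0] := Ploc a; first by rewrite lexx.
  by apply => //; lra.
have Sb : ubound S b by move=> x [/andP[]].
have supS : has_sup S by split; [exists a|exists b].
have as_ : a <= sup S by exact: sup_upper_bound Sa.
have sb : sup S <= b by apply: sup_le_ub => //; exists a.
have [|r r0 Pr] := Ploc (sup S); first by rewrite as_ sb.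
have [x [/andP[ax xb] Pax] rx] := sup_adherent r0 supS.
have xs : x <= sup S by apply: sup_upper_bound => //; split=> //; rewrite ax.
have Pas : P a (sup S) by apply: PD Pax _ => //; apply: Pr => //; lra.
have [bs|sb'] := leP b (sup S).
  by have -> : b = sup S by apply/eqP; rewrite eq_le sb bs.
pose y := Num.min b (sup S + r / 2).
have sy : sup S < y by rewrite lt_min sb'/=; lra.
have yb : y <= b by rewrite ge_min lexx.
have yr : y < sup S + r.
  by apply: (@le_lt_trans _ _ (sup S + r / 2)); [rewrite ge_min lexx orbT|lra].
have : S y.
  split; first by rewrite yb andbT (le_trans as_)// ltW.
  apply: PD Pas _ => //; first exact: ltW.
  by apply: Pr => //; [exact: ltW|lra].
by move=> /(sup_upper_bound supS); rewrite leNgt sy.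
Qed.

(** Induction on the list: the half-line is cut at the right end of the first interval, beyond which
    all the others lie. The moving left bound [x] carries the induction. *)
Lemma length_disjoint_itv (U : set R) (l : seq (R * R)) (x : R) :
  measurable U ->
  pairwise (fun p p' => p.2 <= p'.1) l ->
  {in l, forall p, [/\ x <= p.1, p.1 <= p.2 & `]p.1, p.2[ `<=` U]} ->
  ((\sum_(p <- l) (p.2 - p.1))%:E <= mu (U `&` `[x, +oo[))%E.
Proof.
move=> mU; elim: l x => [|p l IH] x; first by rewrite big_nil.
rewrite pairwise_cons => /andP[pl /IH{}IH] lx.
have [xp p12 pU] := lx p (mem_head _ _).
have mp : measurable (U `&` `[p.2, +oo[) by exact: measurableI.
rewrite big_cons EFinD.
apply: (@le_trans _ _ (mu (`]p.1, p.2[ `|` (U `&` `[p.2, +oo[)))).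
  rewrite measureU//; last first.
    apply/seteqP; split=> // z [/=]; rewrite !in_itv/= andbT => /andP[_ zp] [_].
    by rewrite leNgt zp.
  apply: leeD.
    rewrite /= lebesgue_measure_itv/= lte_fin; case: ltP => // ?.
    by rewrite lee_fin subr_le0.
  apply: IH => p' p'l; have [_ ? ?] : [/\ x <= p'.1, p'.1 <= p'.2 & `]p'.1, p'.2[ `<=` U].
    by apply: lx; rewrite inE p'l orbT.
  by split=> //; exact: (allP pl).
apply: le_measure; rewrite ?inE//.
- exact: measurableU.
- exact: measurableI.
- move=> z [/= zp|[Oz]].
    split; first exact: pU.
    by move: zp; rewrite /= !in_itv/= andbT => /andP[/ltW/(le_trans xp)].
  by rewrite /= !in_itv/= !andbT => pz; split=> //; rewrite (le_trans xp)// (le_trans p12).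
Qed.

(* The points where the derivative is not controlled are covered by an open set
   so small that [f] varies little on it; [cousin] glues the local estimates. *)
Lemma abs_cont_le (f : R -> R) (a b k : R) : a <= b -> abs_cont a b f ->
  {ae mu, forall t, a <= t <= b ->
    exists2 l, is_derive t (1 : R) f l & l <= k} ->
  f b - f a <= k * (b - a).
Proof.
move=> ab acf [N [mN N0 fN]].
apply/ler_addgt0Pr => e0 e0_gt0.
(* The error has three sources: the slack [e] in the slope, worth [e * (b - a)], the variation of
   [f] on the exceptional intervals, and [|k|] times their total length. *)
pose e := e0 / (b - a + 2).
have e_gt0 : 0 < e by rewrite divr_gt0//; lra.
have -> : e0 = e * (b - a) + e + e.
  by rewrite /e; field; apply: lt0r_neq0; lra.
have [d d_gt0 fd] := acf e e_gt0.
pose d' := Num.min d (e / (`|k| + 1)).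
have k1 : 0 < `|k| + 1 by rewrite ltr_wpDl.
have d'_gt0 : 0 < d' by rewrite lt_min d_gt0 divr_gt0.
have muN : (mu N < +oo)%E by rewrite N0 ltry.
have [U [oU NU muU]] := lebesgue_regularity_outer mN muN d'_gt0.
have mU : measurable U by exact: measurable_realfun.open_measurable.
have {}muU : (mu U < d'%:E)%E.
  apply: le_lt_trans muU; rewrite -[leRHS]add0e -N0 /= -measureU//.
  - by rewrite setDUK.
  - exact: measurableD.
  - by rewrite setDIK.
(* The list [l] records the exceptional intervals. There the slope bound may fail, and the increment
   of [f] is paid for by its absolute value; the term in [|k|] compensates a negative [k]. *)
pose good x y := exists l : seq (R * R),
  [/\ pairwise (fun p p' => p.2 <= p'.1) l,
    {in l, forall p, [/\ x <= p.1, p.1 <= p.2, p.2 <= y & `]p.1, p.2[ `<=` U]} &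
    f y - f x <= (k + e) * (y - x) +
      \sum_(p <- l) (`|f p.2 - f p.1| + `|k| * (p.2 - p.1))].
have [l [disl lU fl]] : good a b.
  apply: cousin => // [x y z xy yz [l [dl lU fl]] [l' [dl' lU' fl']]|t tab].
    exists (l ++ l'); split.
    - rewrite pairwise_cat dl dl' !andbT; apply/allrelP => p p' /lU[_ _ py _] /lU'[yp _ _ _].
      exact: le_trans yp.
    - move=> p; rewrite mem_cat => /orP[/lU[? ? py ?]|/lU'[yp ? ? ?]]; split=> //.
        exact: le_trans yz.
      exact: le_trans yp.
    - rewrite big_cat/=; move: fl fl'.
      set s1 := \sum_(_ <- l) _; set s2 := \sum_(_ <- l') _; lra.
  have [Nt|Nt] := pselect (N t).
    have /nbhs_ballP[r /= r0 tU] : nbhs t U by apply: open_nbhs_nbhs; split=> //; exact: NU.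
    exists r => // x y ax xt ty yb tx yt; exists [:: (x, y)]; split=> //.
    - move=> p; rewrite inE => /eqP-> /=; split=> //; first lra.
      move=> z /=; rewrite in_itv/= => /andP[xz zy]; apply: tU.
      rewrite -ball_normE /= ltr_norml; apply/andP; split; lra.
    - rewrite big_seq1/=.
      have := ler_norm (f y - f x); have := lerNnormlW (lexx `|k|).
      have : 0 <= (k + `|k|) * (y - x).
        by apply: mulr_ge0; [have := lerNnormlW (lexx `|k|); lra|lra].
      have : 0 <= e * (y - x) by apply: mulr_ge0; lra.
      lra.
  have [l dft lk] : exists2 l, is_derive t (1 : R) f l & l <= k.
    by apply: contrapT => fNt; apply: Nt; apply: fN => /=; apply/not_implyP.
  have /derivable_nbhsP := @ex_derive _ _ _ _ _ _ _ dft.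
  rewrite derive_val => /eqaddoP/(_ e e_gt0)/nbhs_ballP[r /= r0 tr].
  have {}tr z : `|z - t| < r -> `|f z - f t - (z - t) * l| <= e * `|z - t|.
    move=> zr; have := tr (z - t); rewrite -ball_normE/= sub0r normrN => /(_ zr).
    rewrite !fctE /= [(z - t) *: 1]mulr1 subrK.
    by rewrite opprD addrA.
  exists r => // x y ax xt ty yb tx yt; exists [::]; split=> //.
  rewrite big_nil addr0.
  have := tr y; have := tr x; rewrite (ler0_norm (_ : x - t <= 0)) ?subr_le0//.
  rewrite (ger0_norm (_ : 0 <= y - t)) ?subr_ge0//.
  move=> /(_ ltac:(lra)); rewrite ler_norml => /andP[+ _].
  move=> fx /(_ ltac:(lra)); rewrite ler_norml => /andP[_ fy].
  have : 0 <= (k - l) * (y - x) by apply: mulr_ge0; lra.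
  lra.
have suml : \sum_(p <- l) (p.2 - p.1) < d'.
  rewrite -lte_fin; apply: le_lt_trans muU.
  apply: (@le_trans _ _ (mu (U `&` `[a, +oo[))).
    by apply: length_disjoint_itv => // p /lU[].
  by apply: le_measure; rewrite ?inE//; exact: measurableI.
have sum_ord (F : R * R -> R) : \sum_(p <- l) F p = \sum_(i < size l) F (nth (0, 0) l i).
  by rewrite (big_nth (0, 0)) big_mkord.
have sumf : \sum_(p <- l) `|f p.2 - f p.1| < e.
  rewrite sum_ord; apply: (fd _ (fun i => (nth (0, 0) l i).1) (fun i => (nth (0, 0) l i).2)).
  - by move=> i; have [] := lU _ (mem_nth (0, 0) (ltn_ord i)).
  - move/(pairwiseP (0, 0)) : disl => disl.
    have disl' (i j : 'I_(size l)) (z : R) : (i < j)%N ->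
        z \in `](nth (0, 0) l i).1, (nth (0, 0) l i).2[ ->
        z \in `](nth (0, 0) l j).1, (nth (0, 0) l j).2[ -> False.
      move=> ij /=; rewrite !in_itv/= => /andP[_ zi] /andP[zj _].
      have := disl i j (ltn_ord i) (ltn_ord j) ij.
      by rewrite leNgt (lt_trans zj).
    move=> i j _ _ [z [zi zj]]; apply/val_inj => /=.
    by case: (ltngtP i j) => // [/disl'|/disl'] H; [case: (H _ zi zj)|case: (H _ zj zi)].
  - rewrite -(sum_ord (fun p => p.2 - p.1)); apply: lt_le_trans suml _.
    by rewrite ge_min lexx.
apply: (le_trans fl); rewrite big_split/= -mulr_sumr.
suff : `|k| * \sum_(p <- l) (p.2 - p.1) <= e by lra.
apply: (@le_trans _ _ (`|k| * (e / (`|k| + 1)))).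
  apply: ler_wpM2l => //; apply/ltW/(lt_le_trans suml).
  by rewrite ge_min lexx orbT.
by rewrite mulrCA ler_piMr ?(ltW e_gt0)// ler_pdivrMr// mul1r lerDl.
Qed.

(** A null set contains no interval of positive length. *)
Lemma ae_exists (P : R -> Prop) (a b : R) : a < b ->
  {ae mu, forall t, P t} -> exists2 t, a < t < b & P t.
Proof.
move=> ab [N [mN N0 PN]]; apply: contrapT => nP.
have : (mu `]a, b[ <= mu N)%E.
  apply: le_measure; rewrite ?inE// => t /=; rewrite in_itv/= => tab.
  by apply: PN => Pt; apply: nP; exists t.
by rewrite N0 lebesgue_measure_itv/= lte_fin ab -EFinB lee_fin leNgt subr_gt0 ab.
Qed.

(** With [k < 0] the function would decrease at a definite rate and leave the band of width
    [2 * K]. *)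
Lemma abs_cont_drift (f : R -> R) (k K : R) :
  (forall a b, abs_cont a b f) ->
  {ae mu, forall t, exists2 l, is_derive t (1 : R) f l & l <= k} ->
  {ae mu, forall t, `|f t| <= K} ->
  0 <= k.
Proof.
move=> acf dfk fK; rewrite leNgt; apply/negP => k0.
have [t1 /andP[t1_gt0 t1_lt1] ft1] := ae_exists ltr01 fK.
have K0 : 0 <= K by exact: le_trans ft1.
(* Chosen so that a time lapse of at least [T - 1] forces a drop of at least [2 * K + 1]; [t1 < 1]
   and [T < t2] provide the lapse. *)
pose T := 1 + (2 * K + 1) / - k.
have T1 : 1 <= T by rewrite lerDl divr_ge0; lra.
have TT : T < T + 1 by rewrite ltrDl.
have [t2 /andP[Tt2 t2T] ft2] := ae_exists TT fK.
have t12 : t1 <= t2 by lra.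
have kT : k * (T - 1) = - (2 * K + 1).
  by rewrite /T; field; rewrite lt_eqF.
have : f t2 - f t1 <= k * (t2 - t1).
  by apply: abs_cont_le => //; apply: ae_sub dfk => t + _.
have : k * (t2 - t1) <= k * (T - 1) by rewrite ler_nM2l//; lra.
by move: ft1 ft2; rewrite !ler_norml => /andP[? ?] /andP[? ?]; lra.
Qed.

(** [abs_cont_le] with slope 0, applied to [f] and to its opposite. *)
Lemma abs_cont_constant (f : R -> R) :
  (forall a b, abs_cont a b f) ->
  {ae mu, forall t, is_derive t (1 : R) f 0} ->
  forall s t, f s = f t.
Proof.
move=> acf df.
have le_f s t : s <= t -> f s = f t.
  move=> st; apply/eqP; rewrite eq_le; apply/andP; split; last first.
    rewrite -subr_le0 -(mul0r (t - s)); apply: abs_cont_le => //.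
    by apply: ae_sub df => x dfx _; exists 0.
  rewrite -subr_le0 -[leLHS]opprK opprB.
  have -> : - (f t - f s) = (\- f) t - (\- f) s by rewrite /=; ring.
  rewrite -(mul0r (t - s)); apply: abs_cont_le => //.
    move=> eps /acf-/(_ s t)[d d0 H]; exists d => // n x y xy tr ds.
    by under eq_bigr do rewrite -opprD normrN; exact: H.
  by apply: ae_sub df => x dfx _; exists 0 => //; rewrite -oppr0; exact: is_deriveN.
by move=> s t; have [/le_f//|/ltW/le_f] := leP s t.
Qed.

End absolute_continuity.

Lemma lipschitz_abs_cont (R : realType) (V : normedModType R) (f : R -> V)
    (a b K : R) :
  (forall x y, a <= x -> x <= y -> y <= b -> `|f y - f x| <= K * (y - x)) ->
  abs_cont a b f.
Proof.
move=> fK e e0; exists (e / (`|K| + 1)); first by rewrite divr_gt0// ltr_wpDl.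
move=> n x y xy _; rewrite ltr_pdivlMr ?ltr_wpDl// mulr_suml => xye.
apply: le_lt_trans xye; apply: ler_sum => i _; have [ax le_xy yb] := xy i.
apply: (le_trans (fK _ _ ax le_xy yb)); rewrite mulrC ler_wpM2l ?subr_ge0//.
by rewrite (le_trans (ler_norm _))// lerDl.
Qed.

Lemma derive_lipschitz (R : realType) (f df : R -> R) (a b K : R) :
  (forall t, a <= t <= b -> is_derive t (1 : R) f (df t)) ->
  (forall t, a <= t <= b -> `|df t| <= K) ->
  forall x y, a <= x -> x <= y -> y <= b -> `|f y - f x| <= K * (y - x).
Proof.
move=> fdf dfK x y ax xy yb.
have itv t : x <= t <= y -> a <= t <= b.
  by move=> /andP[xt ty]; rewrite (le_trans ax)// (le_trans ty).
have [| |t] := @MVT_segment R f df x y xy.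
  by move=> t; rewrite in_itv/= => /andP[xt ty]; apply/fdf/itv; rewrite !ltW.
  by apply: derivable_within_continuous => t; rewrite in_itv/= => /itv/fdf[].
rewrite in_itv/= => /itv tab ->.
by rewrite normrM (ger0_norm (_ : 0 <= y - x)) ?subr_ge0// ler_wpM2r ?subr_ge0 ?dfK.
Qed.

(** The continuous derivative is bounded on the compact interval, so each coordinate is Lipschitz
    with the same constant, and hence so is the maximum norm of the increment. *)
Lemma C1_abs_cont (R : realType) n (D : set R) (f : R -> 'rV[R]_n) (a b : R) :
  Ck 1 D f -> `[a, b] `<=` D -> abs_cont a b f.
Proof.
move=> [_ /(_ 1)[df [cDf _]]] abD.
have [ab|ba] := leP a b; last first.
  by apply: (@lipschitz_abs_cont _ _ _ _ _ 0) => x y ax xy yb; lra.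
have inD t : a <= t <= b -> D t by move=> tab; apply: abD; rewrite /= in_itv.
have [|m mab fm] := @EVT_max R (fun t => `|'D_1 f t|) a b ab.
  apply: continuous_in_subspaceT => t; rewrite inE/= in_itv/= => /inD Dt.
  by apply: (@continuous_comp _ _ _ ('D_1 f) Num.norm); [exact: cDf|exact: norm_continuous].
apply: (@lipschitz_abs_cont _ _ _ _ _ `|'D_1 f m|) => x y ax xy yb.
rewrite [leLHS]/Num.Def.normr/= mx_normrE.
apply: bigmax_le => [|[i j] _].
  by rewrite mulr_ge0// subr_ge0.
rewrite !mxE/=.
apply: (@derive_lipschitz _ (fun t => f t i j) (fun t => 'D_1 f t i j) a b) => // t tab.
  have dft := df t (inD t tab).
  split; first by move/derivable_mxP : dft; exact.
  by rewrite derive_mx// mxE.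
apply: le_trans (fm t _); last by rewrite in_itv.
rewrite [leRHS]/Num.Def.normr/= mx_normrE.
exact: (le_bigmax _ (fun ij => `|'D_1 f t ij.1 ij.2|) (i, j)).
Qed.

(** * Left translations and one-parameter subgroups *)

Lemma pair_continuous (R : realType) (V W : normedModType R) (x : V) :
  continuous (pair x : W -> V * W).
Proof. by move=> y; apply: cvg_pair => //; exact: cvg_cst. Qed.

(** The derivative of the slice along [v] is the slice of the derivative along [(0, v)]. This
    extracts left translations from the jointly smooth multiplication. *)
Lemma Ck_slice (R : realType) (V W U : normedModType R) k (A : set (V * W))
    (f : V * W -> U) (x : V) :
  Ck k A f -> Ck k [set y | A (x, y)] (fun y => f (x, y)).
Proof.
have E (h : V * W -> U) (v y : W) :
    (fun t : R => t^-1 *: (((fun y => h (x, y)) \o shift y) (t *: v) - h (x, y))) =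
    (fun t : R => t^-1 *: ((h \o shift (x, y)) (t *: (0, v)) - h (x, y))).
  apply/funext => t /=; congr (_ *: (h _ - _)).
  have -> : t *: ((0, v) : V * W) + (x, y) = (t *: 0 + x, t *: v + y) by [].
  by rewrite scaler0 add0r.
have cslice (h : V * W -> U) (y : W) : {for (x, y), continuous h} ->
    {for y, continuous (fun y => h (x, y))}.
  by move=> ch; apply: (@continuous_comp _ _ _ (pair x) h) => //; exact: pair_continuous.
elim: k f => [|k IH] f [cf df]; first by split=> // y Ay; exact/cslice/cf.
split=> [y Ay|v]; first exact/cslice/cf.
have [dfv Dfv] := df (0, v); split=> [y Ay|].
  by rewrite /derivable E; exact: dfv.
have -> : (fun y => 'D_v (fun y => f (x, y)) y) = (fun y => 'D_(0, v) f (x, y)).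
  by apply/funext => y; rewrite /derive E.
exact: (IH (fun p => 'D_(0, v) f p)).
Qed.

Section left_invariance.
Context {R : realType} {G : topologicalGroupType} {A : set (chart 'rV[R]_4 G)}.
Hypothesis hG : lie_group A.

(** Near a given point, left translation read in charts is the product map with its first argument
    frozen at the coordinates of [a]; [f] in the target chart is then composed with it. *)
Lemma smooth_left_translate (a : G) (f : G -> R) :
  smooth_fun A f -> smooth_fun A (fun x => f (a * x)%g).
Proof.
move=> sf c Ac k; apply: Ck_local => x cx.
have [c0 Ac0 ac0] := lg_cover hG a.
have [c1 Ac1 ac1] := lg_cover hG (a * cinv c x)%g.
pose P (p : 'rV[R]_4 * 'rV[R]_4) := (cinv c0 p.1 * cinv c p.2)%g.
have [Pcont Psmooth] : smooth_into A (ccod c0 `*` ccod c) P := lg_mul hG Ac0 Ac.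
have Pa y : P (cfun c0 a, y) = (a * cinv c y)%g by rewrite /P/= cfunK.
pose D := [set y | ccod c y /\ cdom c1 (a * cinv c y)%g].
have DP y : D y -> (ccod c0 `*` ccod c) (cfun c0 a, y).
  by move=> [cy _]; split=> //; exact: cfun_cod.
have oD : open D.
  rewrite openE => y Dy; have [cy c1y] := Dy.
  have c_near : \forall z \near y, ccod c z.
    by apply: open_nbhs_nbhs; split=> //; exact: ccod_open.
  have cP : {for y, continuous (P \o pair (cfun c0 a))}.
    apply: (@continuous_comp _ _ _ (pair (cfun c0 a)) P); last exact/Pcont/DP.
    exact: pair_continuous.
  have : \forall z \near y, cdom c1 (P (cfun c0 a, z)).
    apply: cP; apply: open_nbhs_nbhs; split; first exact: cdom_open.
    by rewrite /= Pa.
  by apply: filterS2 c_near => z cz; rewrite Pa.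
exists D => //.
pose h y := cfun c1 (a * cinv c y)%g.
have hsm : Ck k D h.
  have := Ck_slice (cfun c0 a) (Psmooth _ Ac1 k).
  have -> : (fun y => (cfun c1 \o P) (cfun c0 a, y)) = h.
    by apply/funext => y; rewrite /= Pa.
  apply: Ck_sub => y Dy; split; first exact: DP.
  by rewrite /= Pa; case: Dy.
apply: (@Ck_eq _ _ _ _ _ ((f \o cinv c1) \o h)) => //.
  by move=> y [_ c1y]; rewrite /h /= cfunK.
apply: (@Ck_comp _ _ _ _ _ (ccod c1)) => //.
- exact: ccod_open.
- by move=> y [_ c1y]; exact: cfun_cod.
- exact: sf.
Qed.

Context {g : vectType R} {br : g -> g -> g} {X : g -> (G -> R) -> (G -> R)}.
Hypothesis hg : lie_algebra_of A br X.

(** The curve tests the two fields only at the point [c t]; left invariance transports the value at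
    any other [x] there, by translating the test function by [x * (c t)^-1]. *)
Lemma velocity_unique (c : R -> G) (t : R) (v w : g) :
  has_velocity A X c t v -> has_velocity A X c t w -> v = w.
Proof.
move=> cv cw; apply: (la_inj hg) => f sf; apply/funext => x.
have sfx := smooth_left_translate (x * (c t)^-1)%g sf.
have Xx z : X z f x = X z (fun y => f (x * (c t)^-1 * y)%g) (c t).
  by rewrite (lif_left (la_field hg z))// mulgVK.
rewrite !Xx; have [_ <-] := cv _ sfx; by have [_ <-] := cw _ sfx.
Qed.

Variable expG : g -> G.
Hypothesis hexp : is_exp A X expG.

(** The one-parameter group law turns the difference quotient at time [t] into the one at time 0 for
    the left-translated function. *)
Lemma exp_velocity (v : g) (t : R) :
  has_velocity A X (fun t : R => expG (t *: v)) t v.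
Proof.
move=> f sf; have [expD _ exp0] := hexp v.
have [dF] := exp0 _ (smooth_left_translate (expG (t *: v)) sf).
rewrite (lif_left (la_field hg v))// -expD addr0 => DF.
have E : (fun h : R => h^-1 *: (((f \o (fun t : R => expG (t *: v))) \o shift t)
      (h *: (1 : R)) - (f \o (fun t : R => expG (t *: v))) t)) =
    (fun h : R => h^-1 *: ((((fun x => f (expG (t *: v) * x)%g) \o
      (fun t : R => expG (t *: v))) \o shift 0) (h *: (1 : R)) -
      ((fun x => f (expG (t *: v) * x)%g) \o (fun t : R => expG (t *: v))) 0)).
  by apply/funext => h /=; rewrite -!expD !addr0 (addrC t).
by split; [rewrite /derivable E|rewrite /derive E].
Qed.

Lemma exp_abs_cont (v : g) :
  abs_cont_curve A [set: R] (fun t : R => expG (t *: v)).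
Proof.
have [_ [cexp sexp] _] := hexp v; split.
  by apply: continuous_subspaceT => t; exact: cexp.
move=> phi Aphi a b _ ab_phi; apply: C1_abs_cont (sexp _ Aphi 1%N) _.
by move=> t tab; split=> //; exact: ab_phi.
Qed.

End left_invariance.

(** * Lie algebra identities, read off from commutators of derivations *)

Section bracket.
Context {R : realType} {G : topologicalGroupType} {A : set (chart 'rV[R]_4 G)}.
Context {g : vectType R} {br : g -> g -> g} {X : g -> (G -> R) -> (G -> R)}.
Hypothesis hg : lie_algebra_of A br X.

Let smX v f : smooth_fun A f -> smooth_fun A (X v f).
Proof. exact: (lif_smooth (la_field hg v)). Qed.

Let XB v f h : smooth_fun A f -> smooth_fun A h ->
  X v (fun x => f x - h x) = (fun x => X v f x - X v h x).
Proof.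
move=> sf sh; have := lif_linear (la_field hg v) (-1) sh sf.
have -> : (fun x => -1 * h x + f x) = (fun x => f x - h x).
  by apply/funext => x; rewrite mulN1r addrC.
by move=> ->; apply/funext => x; rewrite mulN1r addrC.
Qed.

Let X0 f : smooth_fun A f -> X 0 f = (fun=> 0).
Proof.
move=> sf; have := la_linear hg (-1) 0 0 sf.
rewrite scaler0 addr0 => ->.
by apply/funext => x; rewrite mulN1r addNr.
Qed.

Lemma lie_linearl (a : R) (v w z : g) : br (a *: v + w) z = a *: br v z + br w z.
Proof.
apply: (la_inj hg) => f sf; rewrite (la_linear hg)// !(la_bracket hg)//.
rewrite (la_linear hg)//; last exact: smX.
rewrite (la_linear hg)// (lif_linear (la_field hg z)); [|exact: smX|exact: smX].
by apply/funext => x; ring.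
Qed.

Lemma lie_vv (v : g) : br v v = 0.
Proof.
apply: (la_inj hg) => f sf; rewrite X0// (la_bracket hg)//.
by apply/funext => x; rewrite subrr.
Qed.

Lemma lie_anti (v w : g) : br v w = - br w v.
Proof.
apply/eqP; rewrite -addr_eq0; apply/eqP; apply: (la_inj hg) => f sf.
rewrite -[br v w]scale1r (la_linear hg)// !(la_bracket hg)// X0//.
by apply/funext => x; ring.
Qed.

Lemma lie_linearr (a : R) (v w z : g) : br z (a *: v + w) = a *: br z v + br z w.
Proof. by rewrite lie_anti lie_linearl opprD -scalerN -!lie_anti. Qed.

Lemma lie_jacobi (u v w : g) : br u (br v w) = br (br u v) w + br v (br u w).
Proof.
apply: (la_inj hg) => f sf.
rewrite -[br (br u v) w]scale1r (la_linear hg)//.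
rewrite !(la_bracket hg) ?XB //; do ?exact: smX; do ?by do 2!apply: smX.
by apply/funext => x; ring.
Qed.

End bracket.

(** * Normal and abnormal covectors *)

Section normal_covectors.
Context {R : realType} {G : topologicalGroupType} {A : set (chart 'rV[R]_4 G)}.
Hypothesis hG : lie_group A.
Context {g : vectType R} {br : g -> g -> g} {X : g -> (G -> R) -> (G -> R)}.
Hypothesis hg : lie_algebra_of A br X.
Context {expG : g -> G}.
Hypothesis hexp : is_exp A X expG.
Context {q : {vspace g}} {F : g -> R}.
Hypothesis hF : seminorm_on q F.

Lemma bracketZr (a : R) (v w : g) : br v (a *: w) = a *: br v w.
Proof.
have br0 z : br z 0 = 0.
  by have := lie_linearr hg (-1) 0 0 z; rewrite scaler0 addr0 scaleN1r addNr.
by have := lie_linearr hg a w 0 v; rewrite !addr0 br0 addr0.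
Qed.

Lemma bracketZl (a : R) (v w : g) : br (a *: v) w = a *: br v w.
Proof. by rewrite (lie_anti hg) bracketZr -scalerN -(lie_anti hg). Qed.

Lemma bracketDr (v w z : g) : br v (w + z) = br v w + br v z.
Proof. by have := lie_linearr hg 1 w z v; rewrite !scale1r. Qed.

Lemma covector_le_seminorm (l : 'Hom(g, R^o)) (M : R) :
  (forall v, unit_ball q F v -> l v <= M) -> forall w, w \in q -> l w <= M * F w.
Proof.
move=> lM w wq; have [->|w0] := eqVneq w 0.
  have := sn_homogeneous hF (lexx 0) (mem0v q).
  by rewrite scaler0 mul0r linear0 => ->; rewrite mulr0.
have Fw := sn_gt0 hF wq w0.
rewrite -ler_pdivrMr// mulrC.
have -> : (F w)^-1 * l w = l ((F w)^-1 *: w) by rewrite linearZ.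
apply: lM; split; first exact: memvZ.
by rewrite (sn_homogeneous hF)// ?invr_ge0 ?(ltW Fw)// mulVf// gt_eqF.
Qed.

(** An eigencovector of the transpose of [br u] with eigenvalue [r] evolves by the factor
    [expR (r * t)]. The hypothesis on [expR (r * t) * l u] covers the two uses: [l u = 0 = M] for
    the abnormal covector, [r = 0] for a normal one. *)
Lemma pmp_exp_line (u : g) (l : 'Hom(g, R^o)) (r M : R) :
  u \in q -> F u = 1 -> l != 0 -> 0 <= M ->
  (forall v, l (br u v) = r * l v) ->
  (forall t, expR (r * t) * l u = M) ->
  (forall v, unit_ball q F v -> l v <= l u) ->
  pmp A br X q F [set: R] (fun t : R => expG (t *: u)) (fun=> u)
    (fun t => expR (r * t) *: l) M.
Proof.
move=> uq Fu l0 M0 lbr lu lmax.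
have dl v t : is_derive t (1 : R) (fun t => (expR (r * t) *: l) v)
    (r * (expR (r * t) * l v)).
  have -> : (fun t : R => (expR (r * t) *: l) v) = (fun t => l v * expR (r * t)).
    by apply/funext => z; rewrite scale_lfunE; exact: mulrC.
  apply: is_derive_eq; rewrite /GRing.scale/= !mulr1; ring.
split=> //.
- exact: exp_abs_cont.
- by apply: ae_all => t _; split=> //; exact: (exp_velocity hG hg hexp).
- by move=> t _; rewrite scaler_eq0 negb_or gt_eqF ?expR_gt0.
- move=> v a b _.
  (* The exponent [r * t] is at most [|r| * (|a| + |b|)] on the interval, which bounds the
     derivative. *)
  apply: (@lipschitz_abs_cont _ _ _ _ _ (`|r| * (expR (`|r| * (`|a| + `|b|)) * `|l v|))).
  apply: (@derive_lipschitz _ _ (fun t => r * (expR (r * t) * l v)) a b) => // t /andP[at_ tb].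
  rewrite !normrM ler_wpM2l// ler_wpM2r// ger0_norm ?expR_ge0// ler_expR.
  rewrite (le_trans (ler_norm _))// normrM ler_wpM2l// ler_norml.
  have := ler_norm b; have := ler_norm (- a); rewrite normrN.
  by have := normr_ge0 a; have := normr_ge0 b; move=> *; apply/andP; split; lra.
- apply: ae_all => t _ v; have := dl v t.
  by rewrite scale_lfunE lbr /GRing.scale/= mulrCA.
- apply: ae_all => t _; split=> [|v vU]; rewrite !scale_lfunE; first exact: lu.
  by rewrite /GRing.scale/= ler_pM2l ?expR_gt0// lmax.
Qed.

Section normal.
Variables (u : g) (w : R -> g) (psi : R -> 'Hom(g, R^o)) (M : R).
Hypothesis hpmp :
  pmp A br X q F [set: R] (fun t : R => expG (t *: u)) w psi M.

(** The Maximum Principle with [u] in place of the control [w]: by uniqueness of velocities the two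
    agree almost everywhere along the curve. *)
Definition pmp_at (t : R) :=
  [/\ psi t u = M, forall v, unit_ball q F v -> psi t v <= M &
    forall v, is_derive t (1 : R) (fun r => psi r v) (psi t (br u v))].

Lemma pmp_at_ae : {ae @lebesgue_measure R, forall t : R, pmp_at t}.
Proof.
have := ae_and (ae_and (pmp_control hpmp) (pmp_adjoint hpmp)) (pmp_max hpmp).
apply: ae_sub => t [[/(_ I)[_ _ vel] /(_ I) adj] /(_ I)[psiM psimax]].
have wu := velocity_unique hG hg vel (exp_velocity hG hg hexp u t).
by rewrite wu in adj psiM psimax; split=> // v /psimax; rewrite psiM.
Qed.

Lemma pmp_conserved (z : g) : br u z = 0 -> forall r t, psi r z = psi t z.
Proof.
move=> uz; apply: abs_cont_constant => [a b|]; first exact: (pmp_abs_cont hpmp).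
by apply: ae_sub pmp_at_ae => t [_ _ /(_ z)]; rewrite uz linear0.
Qed.

(* [psi z] is constant while [psi y] stays bounded, so [psi (br u y)] cannot
   stay away from zero on one side. *)
Lemma pmp_drift (v z y : g) (t : R) : y \in q -> unit_ball q F v -> br u z = 0 ->
  v = z + br u y -> psi t z <= M.
Proof.
move=> yq vU uz vE; rewrite -subr_ge0.
apply: (@abs_cont_drift _ (fun r => psi r y) _ (Num.max (M * F y) (M * F (- y)))).
- by move=> a b; exact: (pmp_abs_cont hpmp).
- apply: ae_sub pmp_at_ae => r [_ psiM /(_ y) dy]; exists (psi r (br u y)) => //.
  have -> : br u y = v - z by rewrite vE addrC addKr.
  by rewrite linearB/= (pmp_conserved uz t r) lerB// psiM.
- apply: ae_sub pmp_at_ae => r [_ psiM _].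
  have Nyq : - y \in q by rewrite memvN.
  have le1 := covector_le_seminorm psiM yq.
  have := covector_le_seminorm psiM Nyq; rewrite linearN/= => le2.
  by rewrite ler_norml lerNl !le_max le1 le2 orbT.
Qed.

End normal.
End normal_covectors.

(** * Coordinates in the adapted frame and the dual seminorm *)

Lemma frame4_expand (R : realType) (g : vectType R) (br : g -> g -> g)
    (e1 e2 e3 v : g) :
  basis_of fullv (frame4 br e1 e2 e3) ->
  let x k := coord (frame4 br e1 e2 e3) (inord k) v in
  v = x 0%N *: e1 + x 1%N *: e2 + x 2%N *: e3 + x 3%N *: br e1 e3.
Proof.
move=> eB x; rewrite [LHS](coord_basis eB (memvf v)).
under eq_bigr => i _ do rewrite -[in coord _ i v](inord_val i).
rewrite -(big_mkord xpredT (fun i => x i *: (frame4 br e1 e2 e3)`_i)).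
by rewrite !big_nat_recr//= big_geq// add0r.
Qed.

Lemma hom_coord (R : realType) (g : vectType R) n (e : n.-tuple g) (i : 'I_n) :
  exists l : 'Hom(g, R^o), forall v, l v = coord e i v.
Proof.
by exists (linfun (coord e i : {linear g -> R^o})) => v; rewrite lfunE.
Qed.

Lemma mem_span3 (R : realType) (g : vectType R) (q : {vspace g}) (e1 e2 e3 v : g) :
  basis_of q [:: e1; e2; e3] -> v \in q ->
  exists x y z : R, v = x *: e1 + y *: e2 + z *: e3.
Proof.
move=> qB vq; pose e := [tuple e1; e2; e3].
exists (coord e ord0 v), (coord e (lift ord0 ord0) v),
  (coord e (lift ord0 (lift ord0 ord0)) v).
have eB : basis_of q e by [].
by rewrite [LHS](coord_basis eB vq) !big_ord_recl big_ord0 addr0 addrA.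
Qed.

Section dual_seminorm.
Context {R : realType} {g : vectType R} {q : {vspace g}} {F : g -> R}.
Hypothesis hF : seminorm_on q F.
Variables e1 e2 e3 : g.
Hypothesis qB : basis_of q [:: e1; e2; e3].
Variable s : R.
Hypothesis s2 : s * s = 1.

Lemma F_e2_gt0 : 0 < F (s *: e2).
Proof.
apply: (sn_gt0 hF); first by apply/memvZ/(basis_mem qB); rewrite !inE eqxx orbT.
rewrite scaler_eq0 negb_or; apply/andP; split.
  by apply/eqP => s0; move: s2; rewrite s0 mul0r => /eqP; rewrite eq_sym oner_eq0.
have := basis_free qB; rewrite /= => /free_not0 H.
by apply: H; rewrite !inE eqxx orbT.
Qed.

(* When the supremum is infinite, [sup] returns [0], which is not [1 / F]. *)
Lemma F_U_eqP (k : R) :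
  F_U F e1 e2 e3 k s 0 = 1 / F (s *: e2) <->
  forall x y z, F_coord F e1 e2 e3 x y z <= 1 -> k * x + s * y <= 1 / F (s *: e2).
Proof.
have F0 := F_e2_gt0.
rewrite /F_U; set S := [set r | _]; split=> [supE x y z xyz|kU].
  have supS : has_sup S.
    apply: contrapT => nS; move: supE; rewrite (sup_out nS) => /eqP.
    by rewrite eq_sym mulf_eq0 oner_eq0 invr_eq0 gt_eqF.
  rewrite -supE; apply: (sup_upper_bound supS); exists x, y, z; split=> //.
  by rewrite mul0r addr0.
(* The value is attained at the unit vector [s *: e2] divided by [F (s *: e2)], because [s * s = 1];
   so only the upper bound is in question. *)
have SF : S (1 / F (s *: e2)).
  exists 0, (s / F (s *: e2)), 0; split; last first.
    by rewrite !(mulr0, mul0r, add0r, addr0) mulrA s2.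
  rewrite /F_coord !scale0r add0r addr0 mulrC -scalerA (sn_homogeneous hF).
  - by rewrite mulVf// gt_eqF.
  - by rewrite invr_ge0 ltW.
  - by apply/memvZ/(basis_mem qB); rewrite !inE eqxx orbT.
have ubS : ubound S (1 / F (s *: e2)).
  by move=> _ [x [y [z [xyz ->]]]]; rewrite mul0r addr0; exact: kU xyz.
apply/eqP; rewrite eq_le; apply/andP; split.
  by apply: sup_le_ub => //; eexists; exact: SF.
by apply: (sup_upper_bound _ SF); split; [exists (1 / F (s *: e2))|exists (1 / F (s *: e2))].
Qed.

End dual_seminorm.

(** * Abnormal and normal covectors along the one-parameter subgroup of [e2] *)

Theorem theorem1 (R : realType) (G : topologicalGroupType)
    (A : set (chart 'rV[R]_4 G)) (hG : lie_group A)
    (hconn : connected [set: G])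
    (g : vectType R) (br : g -> g -> g) (X : g -> (G -> R) -> (G -> R))
    (hg : lie_algebra_of A br X)
    (expG : g -> G) (hexp : is_exp A X expG)
    (q : {vspace g}) (hdim : \dim q = 3%N) (hgen : generates br q)
    (F : g -> R) (hF : seminorm_on q F)
    (d : G -> G -> R) (hd : sub_finsler_quasimetric A X q F d)
    (e1 e2 e3 : g) (he : adapted_basis br q e1 e2 e3) (he3 : e3 = br e1 e2)
    (s : R) (hs : s = 1 \/ s = -1) :
  let C := struct_const br (frame4 br e1 e2 e3) in
  let Fc := F_coord F e1 e2 e3 in
  let FU := F_U F e1 e2 e3 in
  let c := fun t : R => expG ((s * t / F (s *: e2)) *: e2) in
  abnormal_extremal A br X q F [set: R] c /\
  (nonstrongly_abnormal A br X q F [set: R] c <->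
    (C 2%N 3%N 1%N = 0 /\ C 2%N 3%N 2%N = 0 /\ exists k : R, FU k s 0 = 1 / Fc 0 s 0) \/
    (C 2%N 3%N 1%N != 0 /\ FU (- C 2%N 3%N 2%N * s / C 2%N 3%N 1%N) s 0 = 1 / Fc 0 s 0)).
Proof.
move=> C Fc FU c.
have s2 : s * s = 1 by case: hs => ->; rewrite ?mul1r// mulrNN mulr1.
have s0 : s != 0 by apply/eqP => s0; move: s2; rewrite s0 mul0r => /eqP; rewrite eq_sym oner_eq0.
have qB := ab_basis_q he; have gB := ab_basis he.
have -> : Fc 0 s 0 = F (s *: e2) by rewrite /Fc /F_coord !scale0r add0r addr0.
have F0 : 0 < F (s *: e2) := F_e2_gt0 hF qB s2.
have FUP k := F_U_eqP hF qB s2 k.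
set f := F (s *: e2) in F0 FUP c *.
have [e1q e2q e3q] : [/\ e1 \in q, e2 \in q & e3 \in q].
  by split; apply: (basis_mem qB); rewrite !inE eqxx ?orbT.
pose y := s / f.
have y0 : y != 0 by rewrite mulf_neq0// invr_eq0 gt_eqF.
pose u := y *: e2.
have cE : c = fun t : R => expG (t *: u).
  by apply/funext => t; rewrite /c /u /y scalerA; congr (expG (_ *: _)); ring.
have uq : u \in q by exact: memvZ.
have Fu : F u = 1.
  rewrite /u /y mulrC -scalerA (sn_homogeneous hF) ?invr_ge0 ?(ltW F0) ?memvZ//.
  by rewrite mulVf// gt_eqF.
pose e4 := br e1 e3.
pose a := C 2%N 3%N 1%N; pose b := C 2%N 3%N 2%N; pose r := C 2%N 3%N 3%N.
have H23 : br e2 e3 = a *: e1 + b *: e2 + r *: e3.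
  rewrite [LHS](frame4_expand _ gB) /=.
  by have := ab_C234 he; rewrite /struct_const /= => ->; rewrite scale0r addr0.
have H12 : br e2 e1 = - e3 by rewrite (lie_anti hg) -he3.
(* Jacobi for [e1], [e2], [e3]: the term [br (br e1 e2) e3] is [br e3 e3 = 0], so [br e2 e4] equals
   [br e1 (br e2 e3)]. *)
have H24 : br e2 e4 = b *: e3 + r *: e4.
  have := lie_jacobi hg e1 e2 e3; rewrite -he3 (lie_vv hg) add0r -/e4 => <-.
  rewrite H23 !(bracketDr hg) !(bracketZr hg) (lie_vv hg) scaler0 add0r.
  by rewrite -he3.
have bru v : br u v = y *: br e2 v by rewrite /u (bracketZl hg).
have [l1 l1E] := hom_coord (frame4 br e1 e2 e3) (inord 0).
have [l2 l2E] := hom_coord (frame4 br e1 e2 e3) (inord 1).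
have [l4 l4E] := hom_coord (frame4 br e1 e2 e3) (inord 3).
have frame_free := basis_free gB.
have coordE (i j : nat) : (i < 4)%N -> (j < 4)%N ->
    coord (frame4 br e1 e2 e3) (inord i) (frame4 br e1 e2 e3)`_j = (i == j)%:R.
  move=> i4 j4; have := coord_free (inord j) (inord i) frame_free.
  by rewrite inordK// => ->; rewrite eq_sym -val_eqE /= !inordK.
have l4e : [/\ l4 e1 = 0, l4 e2 = 0, l4 e3 = 0 & l4 e4 = 1].
  by split; rewrite l4E; [exact: (coordE 3%N 0%N)
    |exact: (coordE 3%N 1%N)
    |exact: (coordE 3%N 2%N)
    |exact: (coordE 3%N 3%N)].
have l1e : [/\ l1 e1 = 1, l1 e2 = 0, l1 e3 = 0 & l1 e4 = 0].
  by split; rewrite l1E; [exact: (coordE 0%N 0%N)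
    |exact: (coordE 0%N 1%N)
    |exact: (coordE 0%N 2%N)
    |exact: (coordE 0%N 3%N)].
have l2e : [/\ l2 e1 = 0, l2 e2 = 1, l2 e3 = 0 & l2 e4 = 0].
  by split; rewrite l2E; [exact: (coordE 1%N 0%N)
    |exact: (coordE 1%N 1%N)
    |exact: (coordE 1%N 2%N)
    |exact: (coordE 1%N 3%N)].
(* Being an eigencovector needs checking only on the frame. *)
have hom_ext (l : 'Hom(g, R^o)) (k : R) : l (br e2 e1) = k * l e1 ->
    l (br e2 e2) = k * l e2 -> l (br e2 e3) = k * l e3 ->
    l (br e2 e4) = k * l e4 -> forall v, l (br u v) = (y * k) * l v.
  move=> h1 h2 h3 h4 v; rewrite bru.
  have [x1 [x2 [x3 [x4 ->]]]] : exists x1 x2 x3 x4,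
      v = x1 *: e1 + x2 *: e2 + x3 *: e3 + x4 *: e4.
    by do 4 eexists; exact: frame4_expand.
  rewrite !(bracketDr hg) !(bracketZr hg) !linearZ/= !linearD/= !linearZ/=.
  by rewrite h1 h2 h3 h4 /GRing.scale/=; ring.
(* The coordinate [l4] vanishes on [q] and is an eigencovector with eigenvalue [y * r]. *)
have pmp_abn : exists psi, pmp A br X q F [set: R] c (fun=> u) psi 0.
  have [l41 l42 l43 l44] := l4e.
  have l4u : l4 u = 0 by rewrite linearZ/= l42 scaler0.
  exists (fun t => expR (y * r * t) *: l4); rewrite cE.
  apply: (pmp_exp_line hG hg hexp) => //.
  - apply/eqP => l40; move: l44; rewrite l40 lfunE/= => /eqP.
    by rewrite eq_sym oner_eq0.
  - apply: hom_ext.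
    + by rewrite H12 linearN/= l43 l41 oppr0 mulr0.
    + by rewrite (lie_vv hg) linear0 l42 mulr0.
    + by rewrite H23 !linearD/= !linearZ/= l41 l42 l43 !scaler0 mulr0 !addr0.
    + by rewrite H24 linearD/= !linearZ/= l43 l44 scaler0 add0r.
  - by move=> t; rewrite l4u mulr0.
  - move=> v [/(mem_span3 qB)[x1 [x2 [x3 ->]]] _].
    by rewrite l4u !linearD/= !linearZ/= l41 l42 l43 !scaler0 !addr0.
have maximal psi M : pmp A br X q F [set: R] c (fun=> u) psi M ->
    extremal A br X q F [set: R] c (fun=> u).
  move=> hp; split; first by exists psi, M.
  by move=> I' c' u' psi' M' II' _ _; apply/seteqP; split.
have [psi0 pmp0] := pmp_abn.
split; first by exists (fun=> u); split; [exact: maximal pmp0|exists psi0].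
(* Both conditions are instances: if [a = b = 0] every [k] satisfies the linear equation, and if [a]
   is nonzero its only solution is [- b * s / a]. *)
have sufficiency k : a * k + b * s = 0 -> FU k s 0 = 1 / f ->
    nonstrongly_abnormal A br X q F [set: R] c.
  have [l11 l12 l13 l14] := l1e; have [l21 l22 l23 l24] := l2e.
  move=> kab /FUP kU; pose l := k *: l1 + s *: l2.
  have lE v : l v = k * l1 v + s * l2 v by rewrite add_lfunE !scale_lfunE.
  have lu : l u = 1 / f.
    by rewrite lE /u !linearZ/= l12 l22 -[X in _ = X / _]s2 /y /GRing.scale/=; ring.
  exists (fun=> u); split; [exact: maximal pmp0|by exists psi0|].
  (* A constant covector, written with eigenvalue 0 to fit [pmp_exp_line]. *)
  exists (fun t => expR (y * 0 * t) *: l), (1 / f).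
  split; first by rewrite divr_gt0.
  rewrite cE; apply: (pmp_exp_line hG hg hexp) => //.
  - apply/eqP => l0; have := lE e2; rewrite l0 lfunE/= l12 l22 mulr0 add0r mulr1.
    by move/esym/eqP; rewrite (negbTE s0).
  - by rewrite divr_ge0// ltW.
  - apply: hom_ext.
    + by rewrite H12 linearN/= !lE l13 l23 !mulr0 addr0 oppr0 mul0r.
    + by rewrite (lie_vv hg) linear0 mul0r.
    + rewrite H23 !linearD/= !linearZ/= !lE l11 l12 l13 l21 l22 l23.
      by rewrite mul0r -[RHS]kab /GRing.scale/=; ring.
    + rewrite H24 !linearD/= !linearZ/= !lE l13 l14 l23 l24.
      by rewrite /GRing.scale/=; ring.
  - by move=> t; rewrite mulr0 mul0r expR0 mul1r.
  - move=> v [/(mem_span3 qB)[x1 [x2 [x3 ->]]] Fv].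
    rewrite lu !linearD/= !linearZ/= !lE l11 l12 l13 l21 l22 l23.
    apply: le_trans (kU _ _ _ Fv); rewrite /GRing.scale/=.
    by rewrite le_eqVlt; apply/orP; left; apply/eqP; ring.
split; last first.
  case=> [[a0 [b0 [k kE]]]|[a0 kE]].
    by apply: sufficiency kE; rewrite /a /b a0 b0; ring.
  apply: sufficiency kE; rewrite /a /b; field; exact: a0.

(* Necessity: bounds on a normal covector *)
move=> [w [_ _ [psi [M [M0 hpmp]]]]].
rewrite cE in hpmp.
(* From here on one covector [psi t] suffices; the behaviour over all times enters through
   [pmp_drift]. *)
have [t _ [psiu psiM _]] := ae_exists ltr01 (pmp_at_ae hG hg hexp hpmp).
have drift v z x : x \in q -> unit_ball q F v -> br u z = 0 ->
    v = z + br u x -> psi t z <= M := pmp_drift hG hg hexp hF hpmp t.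
have psi2 : psi t e2 = M * f * s.
  rewrite -psiu linearZ/= /GRing.scale/=.
  have -> : y * psi t e2 * f * s = (s * s) * (f^-1 * f) * psi t e2.
    by rewrite /y; ring.
  by rewrite s2 mulVf ?gt_eqF// !mul1r.
have in_q x1 x2 x3 : x1 *: e1 + x2 *: e2 + x3 *: e3 \in q.
  by rewrite !memvD// memvZ.
have ball0 : unit_ball q F 0.
  split; first exact: mem0v.
  have := sn_homogeneous hF (lexx 0) (mem0v q).
  by rewrite scaler0 mul0r => ->; exact: ler01.
(* Scaling by [M * f] normalizes the [e2]-component of the covector from [M * f * s] to [s]. *)
have bound k : (forall x1 x2 x3, unit_ball q F (x1 *: e1 + x2 *: e2 + x3 *: e3) ->
    (k * (M * f)) * x1 + (M * f * s) * x2 <= M) -> FU k s 0 = 1 / f.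
  move=> kM; apply/FUP => x1 x2 x3 xU.
  rewrite ler_pdivlMr// -(ler_pM2l M0) mulr1.
  apply: le_trans (kM x1 x2 x3 _); last by split.
  by rewrite le_eqVlt; apply/orP; left; apply/eqP; ring.
have Mf0 : M * f != 0 by rewrite mulf_neq0// gt_eqF.
(* [pmp_drift] in coordinates, with bounded direction [p1 *: e1 + p3 *: e3]. The equations on [z1]
   and [z3] say that [z] commutes with [u]; the last three split the ball vector as [z] plus a
   bracket. *)
have drift3 x1 x2 x3 z1 z2 z3 p1 p3 :
    unit_ball q F (x1 *: e1 + x2 *: e2 + x3 *: e3) ->
    a * z3 = 0 -> b * z3 = 0 -> r * z3 = z1 ->
    x1 = z1 + y * (a * p3) -> x2 = z2 + y * (b * p3) ->
    x3 = z3 + y * (r * p3 - p1) ->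
    z1 * psi t e1 + z2 * psi t e2 + z3 * psi t e3 <= M.
  have bre v1 v2 v3 : br u (v1 *: e1 + v2 *: e2 + v3 *: e3) =
      (y * (a * v3)) *: e1 + (y * (b * v3)) *: e2 + (y * (r * v3 - v1)) *: e3.
    rewrite bru !(bracketDr hg) !(bracketZr hg) (lie_vv hg) H12 H23 scaler0 addr0.
    rewrite scalerN -scaleNr !scalerDr !scalerA [LHS]addrC.
    have -> : y * (r * v3 - v1) = y * v3 * r + y * - v1 by ring.
    rewrite scalerDl addrA.
    by congr (_ *: _ + _ *: _ + _ *: _ + _ *: _); ring.
  move=> xU az bz rz xE1 xE2 xE3.
  have <- : psi t (z1 *: e1 + z2 *: e2 + z3 *: e3) =
      z1 * psi t e1 + z2 * psi t e2 + z3 * psi t e3.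
    by rewrite !linearD/= !linearZ.
  apply: (@drift _ _ (p1 *: e1 + 0 *: e2 + p3 *: e3)) xU _ _ => //.
    by rewrite bre az bz rz subrr !mulr0 !scale0r !addr0.
  rewrite bre xE1 xE2 xE3 !scalerDl -!addrA; congr (_ + _).
  by rewrite addrCA; congr (_ + _); rewrite [RHS]addrCA; congr (_ + _); rewrite addrCA.
have zero_ball : unit_ball q F (0 *: e1 + 0 *: e2 + 0 *: e3).
  by rewrite !scale0r !addr0.
have [a0|a0] := eqVneq a 0; last first.
  right; split => //; apply: bound => x1 x2 x3 xU.
  (* Here [z] is a multiple of [e2]: [p3] is solved from the [e1]-equation, [p1] from the
     [e3]-equation, and the [e2]-equation then fixes [z2]. *)
  have := drift3 _ _ _ 0 (x2 - x1 * b / a) 0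
    (r * (x1 / (y * a)) - x3 / y) (x1 / (y * a)) xU.
  rewrite !mulr0 !mul0r !add0r addr0 psi2 => /(_ erefl erefl erefl) H.
  have {}H : (x2 - x1 * b / a) * (M * f * s) <= M.
    by apply: H; field; rewrite ?y0 ?a0.
  apply: le_trans H; rewrite -/a -/b.
  by rewrite le_eqVlt; apply/orP; left; apply/eqP; field.
have b0 : b = 0.
  apply/eqP; apply: contraT => b0.
  (* With [b] nonzero the zero vector splits as [z2 *: e2] plus a bracket; this [z2] makes the
     covector take the value [2 * M] on [z], exceeding [M]. *)
  pose z2 := 2 * s / f; pose p3 := - (z2 / (y * b)).
  have := drift3 0 0 0 0 z2 0 (r * p3) p3 zero_ball.
  rewrite a0 psi2 !mulr0 !mul0r !mulr0 !add0r addr0 subrr mulr0.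
  move=> /(_ erefl erefl erefl erefl) H.
  have : z2 * (M * f * s) <= M.
    by apply: H => //; rewrite /p3; field; rewrite ?y0 ?b0.
  have -> : z2 * (M * f * s) = 2 * M * (s * s).
    by rewrite /z2; field; rewrite gt_eqF.
  by rewrite s2; lra.
left; split=> //; split=> //.
have [r0|r0] := eqVneq r 0.
  have psi3 : psi t e3 = 0.
    apply/eqP; apply: contraT => psi30.
    (* When [br e2 e3 = 0] the vector [z3 *: e3] commutes with [u] and is itself a bracket up to
       sign, so it may be split off from 0; the value [2 * M] is again too large. *)
    pose z3 := 2 * M / psi t e3.
    have := drift3 0 0 0 0 0 z3 (z3 / y) 0 zero_ball.
    rewrite a0 b0 r0 !mul0r !mulr0 !addr0 !add0r.
    move=> /(_ erefl erefl erefl erefl erefl) H.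
    have : z3 * psi t e3 <= M by apply: H; field.
    by rewrite /z3 divfK//; lra.
  exists (psi t e1 / (M * f)); apply: bound => x1 x2 x3 /psiM.
  rewrite !linearD/= !linearZ/= psi2 psi3 scaler0 addr0 divfK//.
  by rewrite /GRing.scale/= mulrC [x2 * _]mulrC.
(* Now [r *: e1 + e3] commutes with [u], so [z] keeps [x1] and [x2] and has third coordinate
   [x1 / r]; [p1] absorbs the difference from [x3]. *)
exists ((psi t e1 + psi t e3 / r) / (M * f)); apply: bound => x1 x2 x3 xU.
have := drift3 _ _ _ x1 x2 (x1 / r) ((x1 / r - x3) / y) 0 xU.
rewrite a0 b0 psi2 !mul0r !mulr0 !addr0 => /(_ erefl erefl) H.
rewrite divfK//; apply: le_trans (H _ erefl erefl _).
- by rewrite le_eqVlt; apply/orP; left; apply/eqP; field.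
- by field.
- by field; rewrite y0.
Qed.
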